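(* Let $\Phi:\mathcal{X}\to\mathbb{R}^{n_{\mathrm{out}}}$, $\mathcal{X}\subset\mathbb{R}^n$, be a continuous map and let $\mathcal{U},\mathcal{V},\mathcal{W}$ be connected subsets of $\mathbb{R}^n$ with $\mathcal{U}\subset\mathcal{V}$, $\partial\mathcal{V}\subset\mathcal{W}\subset\mathcal{X}$, $\mathcal{U}\cap\mathcal{W}=\varnothing$, such that $$[\Phi(x)]_i>c\ \text{ if } x\in\mathcal{U},\qquad [\Phi(x)]_i<c\ \text{ if } x\in\mathcal{W},$$ for some constant $c\in\mathbb{R}$ and some $i\in\{1,\ldots,n_{\mathrm{out}}\}$, where $\partial\mathcal{V}$ denotes the boundary of $\mathcal{V}$ and $[\Phi(x)]_i$ the $i$-th component of $\Phi(x)$. Then, under Assumptions 1 and 2, the map $\Phi$ cannot be embedded in the neural ODE architecture $\mathrm{NODE}_{(2)}$ with $a=0$; i.e. there are no vector field $f$ satisfying Assumptions 1 and 2 and matrix $A\in\mathbb{R}^{n_{\mathrm{out}}\times n}$ such that $\Phi(x)=A\cdot h_x(T)$ for all $x\in\mathcal{X}$.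
   Context: Fix $T>0$. A basic neural ODE is the initial value problem $\frac{dh}{dt}=f(h(t),t)$, $h(0)=x\in\mathcal{X}\subset\mathbb{R}^n$, with $f:\mathbb{R}^n\times[0,T]\to\mathbb{R}^n$ continuous; its solution is denoted $h_x$. A neural ODE with a linear layer is the map $\mathrm{NODE}_{(2)}:\mathcal{X}\to\mathbb{R}^{n_{\mathrm{out}}}$, $\mathrm{NODE}_{(2)}(x):=A\cdot h_x(T)+a$, with $A\in\mathbb{R}^{n_{\mathrm{out}}\times n}$ and $a\in\mathbb{R}^{n_{\mathrm{out}}}$. A map $\Phi$ is embedded in the architecture if $\Phi(x)=\mathrm{NODE}_{(2)}(x)$ for all $x\in\mathcal{X}$. Assumption 1: the vector field $f$ is continuous and the solution of the initial value problem exists for all $t\in[0,T]$. Assumption 2: the vector field $f$ is continuous and the solution of the initial value problem is unique for all $t\in\mathcal{I}$, where $\mathcal{I}$ is the maximal time interval of existence; uniqueness is understood in the sense that solution curves do not cross (two solutions of the ODE that agree at some time agree at all times at which both exist).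
   Formalization: The formal theorem additionally assumes that V is bounded, that U is nonempty (with U ⊂ X made explicit) and that n ≥ 1; without boundedness the claim fails for f = 0, A = I, Φ = id, V = {x₁>0}, U = {x₁>1}, W = {x₁=0}, c = 1/2. *)

(* Defs.v *)
From mathcomp Require Import all_boot all_order all_algebra.
From mathcomp Require Import all_classical all_reals all_analysis.
Set Implicit Arguments.
Unset Strict Implicit.
Unset Printing Implicit Defensive.
Import Order.TTheory GRing.Theory Num.Theory numFieldNormedType.Exports.
Local Open Scope classical_set_scope.
Local Open Scope ring_scope.

Definition boundary (T : topologicalType) (V : set T) : set T :=
  closure V `\` interior V.

(* Vector fields are total functions, but every definition below only uses
   their values at times in [0, T]. *)
Definition continuous_field (R : realType) (n : nat) (T : R)
    (f : 'cV[R]_n -> R -> 'cV[R]_n) : Prop :=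
  {within [set: 'cV[R]_n] `*` `[0, T],
    continuous (fun p : 'cV[R]_n * R => f p.1 p.2)}.

(* h solves dh/dt = f(h(t), t) on J; the difference quotient is restricted to
   J, so the derivative is one-sided at an end point belonging to J. *)
Definition ode_solution (R : realType) (n : nat)
    (f : 'cV[R]_n -> R -> 'cV[R]_n) (J : set R) (h : R -> 'cV[R]_n) : Prop :=
  forall t, J t ->
    (s - t)^-1 *: (h s - h t) @[s --> within J t^'] --> f (h t) t.

Definition ivp_solution (R : realType) (n : nat) (T : R)
    (f : 'cV[R]_n -> R -> 'cV[R]_n) (x : 'cV[R]_n) (h : R -> 'cV[R]_n) : Prop :=
  ode_solution f `[0, T] h /\ h 0 = x.

Definition assumption1 (R : realType) (n : nat) (T : R) (X : set 'cV[R]_n)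
    (f : 'cV[R]_n -> R -> 'cV[R]_n) : Prop :=
  continuous_field T f /\
  forall x, X x -> exists h, ivp_solution T f x h.

(* Solution curves do not cross.  Solutions live on arbitrary subintervals of
   [0, T], so curves that do not exist on all of [0, T] are covered. *)
Definition assumption2 (R : realType) (n : nat) (T : R)
    (f : 'cV[R]_n -> R -> 'cV[R]_n) : Prop :=
  continuous_field T f /\
  forall (J1 J2 : set R) (h1 h2 : R -> 'cV[R]_n),
    is_interval J1 -> is_interval J2 ->
    J1 `<=` `[0, T] -> J2 `<=` `[0, T] ->
    ode_solution f J1 h1 -> ode_solution f J2 h2 ->
    (exists2 t, (J1 `&` J2) t & h1 t = h2 t) ->
    forall t, (J1 `&` J2) t -> h1 t = h2 t.

(* The curve h_x: a chosen solution of the initial value problem on [0, T] (the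
   only one on [0, T] under assumption2), or 0 if there is none. *)
Definition ivp_flow (R : realType) (n : nat) (T : R)
    (f : 'cV[R]_n -> R -> 'cV[R]_n) (x : 'cV[R]_n) : R -> 'cV[R]_n :=
  xget (fun=> 0) [set h | ivp_solution T f x h].

Definition NODE2 (R : realType) (n nout : nat) (T : R)
    (f : 'cV[R]_n -> R -> 'cV[R]_n) (A : 'M[R]_(nout, n)) (a : 'cV[R]_nout)
    (x : 'cV[R]_n) : 'cV[R]_nout :=
  A *m ivp_flow T f x T + a.

Definition embedded (R : realType) (n nout : nat) (T : R) (X : set 'cV[R]_n)
    (Phi : 'cV[R]_n -> 'cV[R]_nout) (f : 'cV[R]_n -> R -> 'cV[R]_n)
    (A : 'M[R]_(nout, n)) (a : 'cV[R]_nout) : Prop :=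
  forall x, X x -> Phi x = NODE2 T f A a x.

(* Main.v *)
Require Import Defs.
From HB Require Import structures.
From mathcomp Require Import all_boot all_order all_algebra.
From mathcomp Require Import all_classical all_reals all_analysis.
From mathcomp Require Import ring lra.
Import Order.TTheory GRing.Theory Num.Theory numFieldNormedType.Exports.
Local Open Scope classical_set_scope.
Local Open Scope ring_scope.

(** Write l y for the i-th entry of A y.  Suppose first that the time-T map P of
    the equation is a homeomorphism of the whole space.  Take u in U and a
    nonzero w with l w >= 0.  The ray P u + s w, s >= 0, stays in the half space
    where l > c, and its preimage under P is a path that starts at u, inside V,
    and tends to infinity, so it leaves the bounded set V.  Being connected, the
    path meets the boundary of V at some x, and there l (P x) > c.  But
    l (P x) = [Phi x]_i < c, because the boundary of V is contained in W.

    The time-T map of f need not be defined on all of V: a solution that starts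
    in V outside X may blow up before time T, and solutions reaching backwards
    from the ray may do so as well.  The argument is therefore run on
    approximations of P that are defined everywhere.  The field f is replaced by
    fields that are Lipschitz in space (lip_field, an infimal convolution), and
    the equation by Euler's scheme with a step so small that every step is a
    bi-Lipschitz bijection of the space (euler_bilipschitz, euler_surjective).
    For such a map the argument above is escape_through_boundary; no degree
    theory enters, since the approximations are invertible by construction.

    What remains is to choose one approximation P_j with l (P_j u) > c and
    l (P_j x) <= c on the whole boundary of V.  If there were none, some x_j in
    the boundary would satisfy l (P_j x_j) > c for all large j.  The boundary is
    compact, so x_j tends to some x in it along an ultrafilter, and
    euler_curve_cvg says that P_j x_j tends to h_x(T), whence
    [Phi x]_i = l (h_x(T)) >= c, a contradiction.

    Convergence along an ultrafilter takes the place of the Arzela-Ascoli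
    theorem: bounded Euler curves have pointwise limits for free, and the
    estimate of their increments (euler_drift), which bounds them locally, also
    passes to pointwise limits and shows that a limit solves the equation.
    Non-crossing of solutions then identifies the limit with h_x. *)

Set Implicit Arguments.
Unset Strict Implicit.
Unset Printing Implicit Defensive.

(** * Column vectors *)

Lemma ler_cV_norm (R : realType) (n : nat) (x : 'cV[R]_n) (e : R) :
  0 <= e -> (forall k, `|x k 0| <= e) -> `|x| <= e.
Proof.
move=> e0 H; rewrite /Num.norm/= mx_normrE.
by apply: bigmax_le => // -[k l] _ /=; rewrite (ord1 l).
Qed.

Lemma ler_entry_cV_norm (R : realType) (n : nat) (x : 'cV[R]_n) k :
  `|x k 0| <= `|x|.
Proof.
rewrite [leRHS]/Num.norm/= mx_normrE.
by apply/bigmax_geP; right; exists (k, 0).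
Qed.

Lemma cV_closed_ball_compact (R : realType) (n : nat) (B : R) :
  compact [set x : 'cV[R]_n | `|x| <= B].
Proof.
have tr_le (m p : nat) (x : 'M[R]_(m, p)) : `|x^T| <= `|x|.
  rewrite [leLHS]/Num.norm/= mx_normrE; apply: bigmax_le => // -[k l] _ /=.
  rewrite mxE [leRHS]/Num.norm/= mx_normrE.
  by apply/bigmax_geP; right; exists (l, k).
have tr_eq (m p : nat) (x : 'M[R]_(m, p)) : `|x^T| = `|x|.
  by apply/le_anti; rewrite tr_le -{1}[x]trmxK tr_le.
have -> : [set x : 'cV[R]_n | `|x| <= B] =
          trmx @` [set x : 'rV[R]_n | `|x| <= B].
  apply/seteqP; split => [x xB|_ [x xB <-]] /=; last by rewrite tr_eq.
  by exists x^T; rewrite ?trmxK//= tr_eq.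
apply: continuous_compact.
  apply: continuous_subspaceT => x.
  apply/(@cvgrPdist_le _ _ _ (nbhs x)) => e e0.
  near=> y; rewrite -linearB/= tr_eq; near: y.
  by apply: (@cvgr_dist_le _ _ _ (nbhs x) _ id) => //; exact: cvg_id.
apply: bounded_closed_compact.
  exists B; split; rewrite ?num_real// => M BM x /= /le_trans; apply.
  exact: ltW.
have -> : [set x : 'rV[R]_n | `|x| <= B] =
          (fun x : 'rV[R]_n => `|x|) @^-1` [set r | r <= B] by [].
by apply: preimage_closed (@closed_le _ B) => x _; exact: norm_continuous.
Unshelve. all: by end_near. Qed.

(** Convergence along a fixed ultrafilter spares the extraction of
    subsequences: all bounded sequences converge at once. *)
Lemma ultra_bounded_cvg (R : realType) (n : nat) (F : set_system nat)
    (u : nat -> 'cV[R]_n) (B : R) :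
  UltraFilter F -> (\forall j \near F, `|u j| <= B) -> cvg (u @ F).
Proof.
move=> UF uB.
have UF' : UltraFilter (u @ F).
  split; first exact: fmap_proper_filter.
  move=> G PG FG; apply/seteqP; split => //= A GA.
  have [//|FnA] := in_ultra_setVsetC (u @^-1` A) UF.
  exfalso; apply: (@filter_not_empty _ G).
  have GnA : G (~` A) by apply: FG.
  by rewrite -(setICr A); apply: filterI.
have := @cV_closed_ball_compact R n B; rewrite compact_ultra.
by move=> /(_ _ UF' uB)[z [_ uz]]; apply/cvg_ex; exists z.
Qed.

(** * Lipschitz envelopes *)

Definition clamp (R : realType) (b r : R) : R := Num.max (- b) (Num.min b r).

Lemma clamp_bound (R : realType) (b r : R) : 0 <= b -> - b <= clamp b r <= b.
Proof.
by move=> b0; rewrite /clamp le_max lexx/= ge_max ge_min lexx/= andbT; lra.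
Qed.

Lemma clamp_id (R : realType) (b r : R) : - b <= r <= b -> clamp b r = r.
Proof. by move=> /andP[br rb]; rewrite /clamp min_r// max_r. Qed.

Section lipschitz_envelope.
Context {R : realType} {V : normedModType R}.

(** The Moreau-Pasch-Hausdorff envelope, the largest L-Lipschitz minorant, of
    phi truncated at levels - b and b.  The truncation makes the infimum finite
    without any growth condition on phi. *)
Definition lip_envelope (b L : R) (phi : V -> R) (x : V) : R :=
  inf (range (fun y => clamp b (phi y) + L * `|x - y|)).

Variables (b L : R) (phi : V -> R).
Hypotheses (b0 : 0 <= b) (L0 : 0 <= L).

Lemma lip_envelope_le (x y : V) :
  lip_envelope b L phi x <= clamp b (phi y) + L * `|x - y|.
Proof.
apply: ge_inf; last by exists y.
exists (- b) => _ [z _ <-]; have /andP[bz _] := clamp_bound (phi z) b0.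
by rewrite (le_trans bz)// lerDl mulr_ge0.
Qed.

Lemma lip_envelope_ge (x : V) (r : R) :
  (forall y, r <= clamp b (phi y) + L * `|x - y|) ->
  r <= lip_envelope b L phi x.
Proof.
move=> H; apply: lb_le_inf => [|_ [y _ <-]]; last exact: H.
by exists (clamp b (phi 0) + L * `|x - 0|); exists 0.
Qed.

Lemma lip_envelope_lipschitz (x y : V) :
  `|lip_envelope b L phi x - lip_envelope b L phi y| <= L * `|x - y|.
Proof.
wlog suff H : x y /
    lip_envelope b L phi x - lip_envelope b L phi y <= L * `|x - y|.
  by rewrite ler_norml H andbT lerNl opprB distrC H.
rewrite lerBlDl -lerBlDr; apply: lip_envelope_ge => z.
rewrite lerBlDr; apply: (le_trans (lip_envelope_le x z)).
by rewrite -addrA lerD2l -mulrDr ler_wpM2l// [leRHS]addrC ler_distD.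
Qed.

(** The competitors at distance at least r from x cost at least L * r - b, which
    the third hypothesis makes too large to matter. *)
Lemma lip_envelope_near (x : V) (v e r : R) :
  0 < r -> `|v| + e <= b -> b + `|v| + e <= L * r ->
  (forall y, `|x - y| < r -> `|phi y - v| <= e) ->
  `|lip_envelope b L phi x - v| <= e.
Proof.
move=> r0 veb vbL H.
have e0 : 0 <= e.
  by rewrite (le_trans (normr_ge0 (phi x - v)))// H// subrr normr0.
have cl y : `|x - y| < r -> clamp b (phi y) = phi y.
  move=> /H; rewrite ler_norml => /andP[? ?]; apply: clamp_id.
  by have := ler_norm v; have := ler_norm (- v); rewrite normrN; lra.
rewrite ler_norml; apply/andP; split; last first.
  have := lip_envelope_le x x.
  rewrite subrr normr0 mulr0 addr0 cl ?subrr ?normr0//.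
  have := H x; rewrite subrr normr0 => /(_ r0).
  rewrite ler_norml => /andP[_ ?] ?.
  by lra.
rewrite lerBrDr; apply: lip_envelope_ge => y.
have [xyr|rxy] := ltP `|x - y| r.
  rewrite cl//; have := H _ xyr; rewrite ler_norml => /andP[? _].
  have : 0 <= L * `|x - y| by rewrite mulr_ge0.
  by lra.
have /andP[bz _] := clamp_bound (phi y) b0.
have := ler_wpM2l L0 rxy; have := ler_norm v.
by lra.
Qed.
End lipschitz_envelope.

(** * Euler's scheme *)

(** d *: g is (1/2)-Lipschitz, so adding it to the identity multiplies distances
    by a factor between 1/2 and 3/2. *)
Lemma perturbation_bilipschitz (R : realType) (V : normedModType R)
    (d L : R) (g : V -> V) (x y : V) :
  0 <= d -> d * L <= 2^-1 -> (forall x y, `|g x - g y| <= L * `|x - y|) ->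
  `|(x + d *: g x) - (y + d *: g y)| <= 2 * `|x - y| /\
  `|x - y| <= 2 * `|(x + d *: g x) - (y + d *: g y)|.
Proof.
move=> d0 dL Lg.
have -> : (x + d *: g x) - (y + d *: g y) = (x - y) + d *: (g x - g y).
  by rewrite scalerBr opprD addrACA.
have small : `|d *: (g x - g y)| <= 2^-1 * `|x - y|.
  rewrite normrZ ger0_norm// (le_trans (ler_wpM2l d0 (Lg x y)))//.
  by rewrite mulrA ler_wpM2r.
have := ler_normD (x - y) (d *: (g x - g y)).
have := lerB_normD (x - y) (d *: (g x - g y)).
have := normr_ge0 (x - y).
by split; lra.
Qed.

(** A preimage of y is a fixed point of the contraction x |-> y - d *: g x. *)
Lemma perturbation_surjective (R : realType) (V : completeNormedModType R)
    (d L : R) (g : V -> V) (y : V) :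
  0 <= d -> d * L <= 2^-1 -> (forall x y, `|g x - g y| <= L * `|x - y|) ->
  exists x, x + d *: g x = y.
Proof.
move=> d0 dL Lg.
pose h x := y - d *: g x.
have hfun : isFun V V setT setT h by split.
pose H : {fun [set: V] >-> [set: V]} := HB.pack h hfun.
have [|||x _ xE] := @banach_fixed_point R V setT H.
- exists (2^-1)%:nng; split => /=; first by rewrite invf_lt1 ?ltr1n.
  move=> [u v] _ /=.
  rewrite /h opprD addrACA subrr add0r opprK addrC -scalerBr normrZ ger0_norm//.
  rewrite distrC (le_trans (ler_wpM2l d0 (Lg u v)))//.
  by rewrite mulrA ler_wpM2r.
- exact: closedT.
- by exists 0.
- by exists x; rewrite {1}xE /= /h subrK.
Qed.

Section euler.
Context {R : realType}.

Fixpoint euler (V : normedModType R) (d : R) (g : V -> R -> V) (x : V)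
    (k : nat) : V :=
  if k is k'.+1 then
    let y := euler d g x k' in y + d *: g y (k'%:R * d)
  else x.

Variables (d L : R).
Hypotheses (d0 : 0 <= d) (dL : d * L <= 2^-1).

Lemma euler_bilipschitz (V : normedModType R) (g : V -> R -> V) (x y : V) k :
  (forall t x y, `|g x t - g y t| <= L * `|x - y|) ->
  `|euler d g x k - euler d g y k| <= 2 ^+ k * `|x - y| /\
  `|x - y| <= 2 ^+ k * `|euler d g x k - euler d g y k|.
Proof.
move=> Lg; elim: k => [|k [up lo]] /=; first by rewrite expr0 mul1r lexx.
have [up1 lo1] := perturbation_bilipschitz (euler d g x k) (euler d g y k)
  d0 dL (Lg (k%:R * d)).
split.
  by rewrite (le_trans up1)// exprS -mulrA ler_wpM2l.
by rewrite (le_trans lo)// exprSr -mulrA ler_wpM2l// exprn_ge0.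
Qed.

Lemma euler_surjective (V : completeNormedModType R) (g : V -> R -> V) k
    (y : V) :
  (forall t x y, `|g x t - g y t| <= L * `|x - y|) ->
  exists x, euler d g x k = y.
Proof.
move=> Lg; elim: k y => [|k IH] y /=; first by exists y.
have [z zy] := perturbation_surjective y d0 dL (Lg (k%:R * d)).
by have [x xz] := IH z; exists x; rewrite xz.
Qed.

End euler.

(** As long as the scheme stays in the region where g is within e of v, its
    increments are within e of those of a motion with velocity v.  The last
    hypothesis leaves enough room around y for the scheme not to leave that
    region, so the estimate and the confinement are proved together. *)
Lemma euler_drift (R : realType) (V : normedModType R) (T : R) (d : R)
    (g : V -> R -> V) (x y v : V) (r e eta : R) (a m : nat) :
  0 < d -> 0 <= e ->
  (forall z s, `|z - y| < eta -> `|s - r| < eta -> 0 <= s <= T ->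
    `|g z s - v| <= e) ->
  `|a%:R * d - r| < eta -> `|(a + m)%:R * d - r| < eta -> (a + m)%:R * d <= T ->
  `|euler d g x a - y| + (`|v| + e) * (m%:R * d) < eta ->
  `|euler d g x (a + m) - euler d g x a - (m%:R * d) *: v| <= e * (m%:R * d).
Proof.
move=> d0 e0 gv ar; elim: m => [|m IH] mr mT near.
  by rewrite addn0 subrr mul0r scale0r subrr normr0 mulr0.
have mS : m.+1%:R * d = m%:R * d + d by rewrite -natr1 mulrDl mul1r.
have amS : (a + m.+1)%:R * d = (a + m)%:R * d + d.
  by rewrite addnS -natr1 mulrDl mul1r.
have ma : (a + m)%:R * d = a%:R * d + m%:R * d by rewrite natrD mulrDl.
have md0 : 0 <= m%:R * d by rewrite mulr_ge0// ltW.
have ad0 : 0 <= a%:R * d by rewrite mulr_ge0// ltW.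
have amr : `|(a + m)%:R * d - r| < eta.
  by move: ar mr; rewrite !ltr_norml amS; lra.
have ve0 : 0 <= `|v| + e by rewrite addr_ge0.
have amT : (a + m)%:R * d <= T by lra.
have mnear : `|euler d g x a - y| + (`|v| + e) * (m%:R * d) < eta.
  by apply: le_lt_trans near; rewrite lerD2l ler_wpM2l// mS lerDl ltW.
have {}IH := IH amr amT mnear.
have close : `|euler d g x (a + m) - y| < eta.
  apply: le_lt_trans mnear; rewrite mulrDl.
  have split_drift (p q w : V) : q - y = (p - y) + (w + (q - p - w)).
    by rewrite [w + _]addrC subrK [RHS]addrC addrA subrK.
  rewrite (split_drift (euler d g x a) _ ((m%:R * d) *: v)).
  rewrite (le_trans (ler_normD _ _))// lerD2l.
  rewrite (le_trans (ler_normD _ _))// lerD//.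
  by rewrite normrZ ger0_norm// mulrC.
have gs : `|g (euler d g x (a + m)) ((a + m)%:R * d) - v| <= e.
  apply: gv => //; apply/andP; split; last exact: amT.
  by rewrite mulr_ge0// ltW.
rewrite addnS /= mS scalerDl mulrDr.
have regroup (p q w z : V) :
    p + z - q - (w + d *: v) = (p - q - w) + (z - d *: v).
  by rewrite opprD (addrAC p) addrACA.
rewrite regroup.
rewrite (le_trans (ler_normD _ _))// lerD// -scalerBr normrZ gtr0_norm//.
by rewrite mulrC ler_wpM2r// ltW.
Qed.

(** * Escaping from a bounded set *)

Lemma connected_meets_boundary (T : topologicalType) (C S : set T) :
  connected C -> C `&` S !=set0 -> C `&` ~` S !=set0 ->
  C `&` boundary S !=set0.
Proof.
move=> conC [x [Cx Sx]] [y [Cy nSy]].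
apply: contrapT => /set0P/negP/negPn/eqP CS0.
have clint z : C z -> closure S z -> interior S z.
  move=> Cz Sz; apply: contrapT => nSz.
  by have : (C `&` boundary S) z by []; rewrite CS0.
suff CE : C `&` interior S = C.
  by have : C y by []; rewrite -CE => -[_ /interior_subset].
apply: conC.
- by exists x; split => //; apply: clint => //; exact: subset_closure.
- by exists (interior S) => //; exact: open_interior.
- exists (closure S); first exact: closed_closure.
  apply/seteqP; split => z [Cz Sz]; split => //; last exact: clint.
  by apply: subset_closure; exact: interior_subset.
Qed.

(** The preimage under P of the ray from P u in a direction in which l does not
    decrease is a path from u to infinity, along which l (P x) > k. *)
Lemma escape_through_boundary (R : realType) (V : normedModType R)
    (P : V -> V) (l : V -> R) (C k : R) (S : set V) (u w : V) :
  w != 0 -> (forall s x y, l (x + s *: y) = l x + s * l y) ->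
  0 < C -> (forall y, exists x, P x = y) ->
  (forall x y, `|x - y| <= C * `|P x - P y|) ->
  (forall x y, `|P x - P y| <= C * `|x - y|) ->
  bounded_set S -> S u -> k < l (P u) ->
  exists2 x, boundary S x & k < l (P x).
Proof.
move=> w0 llin C0 /choice[Q QP] lo up bS Su ku.
wlog lw0 : w w0 / 0 <= l w.
  move=> H; have [lw|lw] := leP 0 (l w); first exact: (H w).
  apply: (H (- w)); first by rewrite oppr_eq0.
  have := llin 1 0 0; have := llin (-1) 0 w.
  rewrite scale1r addr0 scaleN1r add0r.
  by lra.
pose gam s := Q (P u + s *: w).
have gamP s : P (gam s) = P u + s *: w by rewrite /gam QP.
have gam0 : gam 0 = u.
  apply/eqP; rewrite -subr_eq0 -normr_le0 (le_trans (lo _ _))//.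
  by rewrite gamP scale0r addr0 subrr normr0 mulr0.
have gam_lip s t : `|gam s - gam t| <= C * `|w| * `|s - t|.
  rewrite (le_trans (lo _ _))// !gamP opprD addrACA subrr add0r.
  rewrite -scalerBl normrZ.
  by rewrite -mulrA (mulrC `|w|).
have gam_cont : continuous gam.
  move=> s; apply/(@cvgrPdist_le _ _ _ (nbhs s)) => e e0.
  have Cw : 0 < C * `|w| by rewrite mulr_gt0// normr_gt0.
  have eCw : 0 < e / (C * `|w|) by rewrite divr_gt0.
  near=> t; rewrite (le_trans (gam_lip _ _))// -ler_pdivlMl// mulrC.
  near: t.
  exact: (@cvgr_dist_le _ _ _ (nbhs s) _ id s (@cvg_id _ (nbhs s)) _ eCw).
have [M [Mreal SM]] := bS.
pose M' := `|M| + 1.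
have SM' x : S x -> `|x| <= M'.
  by move=> Sx; apply: (SM M') => //=; have := ler_norm M; rewrite /M'; lra.
(* s1 is large enough for gam s1 to be at distance at least 2 M' + 1 from u,
   hence outside the ball of radius M', which contains S. *)
pose s1 := C * (2 * M' + 1) / `|w|.
have nw : 0 < `|w| by rewrite normr_gt0.
have M'0 : 0 <= M' by rewrite addr_ge0.
have s10 : 0 <= s1 by rewrite divr_ge0// mulr_ge0// ?ltW//; lra.
have nS : ~ S (gam s1).
  move=> /SM' gM; have := SM' _ Su => uM.
  have := up (gam s1) u; rewrite gamP addrAC subrr add0r normrZ ger0_norm//.
  rewrite /s1 divfK ?gt_eqF//.
  by rewrite ler_pM2l//; have := ler_normB (gam s1) u; lra.
have [x [[s s0 <-] Sx]] : (gam @` `[0, s1]) `&` boundary S !=set0.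
  apply: connected_meets_boundary.
  - apply: connected_continuous_connected; first exact: segment_connected.
    exact: continuous_subspaceT.
  - by exists u; split => //; exists 0; rewrite //= in_itv/= lexx.
  - by exists (gam s1); split => //; exists s1; rewrite //= in_itv/= lexx s10.
exists (gam s) => //; rewrite gamP llin (lt_le_trans ku)// lerDl mulr_ge0//.
by move: s0; rewrite /= in_itv/= => /andP[].
Unshelve. all: by end_near. Qed.

(** * Limits of Euler curves *)

Lemma ode_solution_continuous (R : realType) (n : nat)
    (f : 'cV[R]_n -> R -> 'cV[R]_n) (J : set R) (h : R -> 'cV[R]_n) (t e : R) :
  ode_solution f J h -> J t -> 0 < e ->
  exists2 eta, 0 < eta & forall s, J s -> `|s - t| < eta -> `|h s - h t| <= e.
Proof.
move=> hJ Jt e0; set K := `|f (h t) t| + 1.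
have K0 : 0 < K by rewrite ltr_wpDl.
have /cvgr_dist_le/(_ _ ltr01) := hJ _ Jt.
move=> /nbhs_ballP[eta /= eta0 H].
exists (Num.min eta (e / K)); first by rewrite lt_min eta0 divr_gt0.
move=> s Js; rewrite lt_min ltr_pdivlMr// => /andP[st stK].
have [->|nst] := eqVneq s t; first by rewrite subrr normr0 ltW.
have st0 : s - t != 0 by rewrite subr_eq0.
have := H s; rewrite -ball_normE /= distrC => /(_ st nst Js) q1.
have hq : h s - h t = (s - t) *: ((s - t)^-1 *: (h s - h t)).
  by rewrite scalerA divff// scale1r.
rewrite hq normrZ (le_trans _ (ltW stK))// ler_wpM2l//.
rewrite -[X in `|X| <= _](subrK (f (h t) t)).
rewrite (le_trans (ler_normD _ _))//.
by rewrite addrC lerD2l distrC.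
Qed.

(** Piecewise constant interpolation: its increments between arbitrary times are
    increments of the scheme between grid times, and its jumps vanish in the
    limit. *)
Definition euler_curve (R : realType) (V : normedModType R) (d : R)
  (g : V -> R -> V) (x : V) (t : R) : V := euler d g x (Num.truncn (t / d)).

(** Continuous convergence of g j to f: uniform near every point of space-time,
    which also bounds the fields g j locally, uniformly in all large j. *)
Definition consistent (R : realType) (V : normedModType R) (F : set_system nat)
    (T : R) (f : V -> R -> V) (g : nat -> V -> R -> V) : Prop :=
  forall y r, 0 <= r <= T -> forall e, 0 < e ->
  exists2 eta, 0 < eta & \forall j \near F, forall z s,
    `|z - y| < eta -> `|s - r| < eta -> 0 <= s <= T -> `|g j z s - f y r| <= e.

Section euler_limit.
Context {R : realType} {n : nat} {F : set_system nat} {UF : UltraFilter F}.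
Variables (T : R) (g : nat -> 'cV[R]_n -> R -> 'cV[R]_n) (d : nat -> R).
Variable (x : nat -> 'cV[R]_n).
Hypotheses (d0 : forall j, 0 < d j) (dF : d j @[j --> F] --> 0).

Let p t j := euler_curve (d j) (g j) (x j) t.

Lemma grid_cvg s : 0 <= s ->
  (Num.truncn (s / d j))%:R * d j @[j --> F] --> s.
Proof.
move=> s0; apply/cvgrPdist_le => e e0; near=> j.
have sd : 0 <= s / d j by rewrite divr_ge0// ltW.
have /andP[lo hi] := truncn_itv sd.
have {}lo : (Num.truncn (s / d j))%:R * d j <= s by rewrite -ler_pdivlMr.
have {}hi : s < (Num.truncn (s / d j)).+1%:R * d j by rewrite -ltr_pdivrMr.
have de : d j <= e.
  have : `|0 - d j| <= e by near: j; exact: cvgr_dist_le.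
  by rewrite sub0r normrN gtr0_norm.
move: hi; rewrite -natr1 mulrDl mul1r ger0_norm ?subr_ge0//; lra.
Unshelve. all: by end_near. Qed.

(** The limit form of the drift estimate.  It yields existence of the limit at
    time s2 as well, because the estimate bounds the curves there. *)
Lemma euler_drift_limit (y v z1 : 'cV[R]_n) (r e eta s1 s2 : R) :
  0 <= e ->
  (\forall j \near F, forall z s, `|z - y| < eta -> `|s - r| < eta ->
    0 <= s <= T -> `|g j z s - v| <= e) ->
  0 <= s1 <= s2 -> s2 <= T -> `|s1 - r| < eta -> `|s2 - r| < eta ->
  p s1 @ F --> z1 -> `|z1 - y| + (`|v| + e) * (s2 - s1) < eta ->
  exists2 z2, p s2 @ F --> z2 & `|z2 - z1 - (s2 - s1) *: v| <= e * (s2 - s1).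
Proof.
move=> e0 gv /andP[s10 s12] s2T s1r s2r pz1 room.
have s20 : 0 <= s2 by lra.
pose a j := Num.truncn (s1 / d j).
pose m j := (Num.truncn (s2 / d j) - a j)%N.
have am j : (a j + m j)%N = Num.truncn (s2 / d j).
  by rewrite subnKC// le_truncn// ler_pM2r ?invr_gt0.
have cA : (a j)%:R * d j @[j --> F] --> s1 by exact: grid_cvg.
have cB : (a j + m j)%:R * d j @[j --> F] --> s2.
  by under eq_fun do rewrite am; exact: grid_cvg.
have cm : (m j)%:R * d j @[j --> F] --> s2 - s1.
  have -> : (fun j => (m j)%:R * d j) =
      (fun j => (a j + m j)%:R * d j - (a j)%:R * d j).
    by apply/funext => j; rewrite natrD mulrDl addrAC subrr add0r.
  exact: cvgB.
have dist_lt (q : nat -> R) s : q j @[j --> F] --> s -> `|s - r| < eta ->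
    \forall j \near F, `|q j - r| < eta.
  move=> qs; apply: cvgr_lt; apply: cvg_norm; apply: cvgB => //; exact: cvg_cst.
have drift : \forall j \near F,
    `|p s2 j - p s1 j - ((m j)%:R * d j) *: v| <= e * ((m j)%:R * d j).
  near=> j; rewrite /p /euler_curve -am.
  apply: (@euler_drift _ _ T _ _ _ y _ r _ eta) => //.
  - by near: j.
  - by near: j; exact: dist_lt cA s1r.
  - by near: j; exact: dist_lt cB s2r.
  - rewrite am (le_trans _ s2T)// -ler_pdivlMr// truncn_le.
    by rewrite divr_ge0// ltW.
  - near: j; apply: cvgr_lt room.
    apply: cvgD; first by apply: cvg_norm; apply: cvgB => //; exact: cvg_cst.
    by apply: cvgM => //; exact: cvg_cst.
have cbound :
    `|p s1 j| + `|((m j)%:R * d j) *: v| + e * ((m j)%:R * d j) @[j --> F]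
    --> `|z1| + `|(s2 - s1) *: v| + e * (s2 - s1).
  apply: cvgD; last by apply: cvgM => //; exact: cvg_cst.
  by apply: cvgD; apply: cvg_norm => //; apply: cvgZ => //; exact: cvg_cst.
have /cvg_ex[z2 pz2] : cvg (p s2 @ F).
  apply: (@ultra_bounded_cvg _ _ _ _
    (`|z1| + `|(s2 - s1) *: v| + e * (s2 - s1) + 1)).
  near=> j; apply: (@le_trans _ _
    (`|p s1 j| + `|((m j)%:R * d j) *: v| + e * ((m j)%:R * d j))); last first.
    by near: j; apply: (cvgr_le _ cbound); rewrite ltrDl.
  have -> : p s2 j = p s1 j + ((m j)%:R * d j) *: v +
      (p s2 j - p s1 j - ((m j)%:R * d j) *: v).
    by rewrite -(addrA _ (- _)) -opprD addrCA subrr addr0.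
  rewrite (le_trans (ler_normD _ _))// lerD//; first exact: ler_normD.
  by near: j.
exists z2 => //.
apply: ler_cvg_to drift.
  apply: cvg_norm; apply: cvgB; first exact: cvgB.
  by apply: cvgZ => //; exact: cvg_cst.
by apply: cvgM => //; exact: cvg_cst.
Unshelve. all: by end_near. Qed.

(** Let sg be the supremum of the times up to which the curves converge to h.
    Around (h sg, sg) the fields g j are bounded by K, so from a time t slightly
    before sg the curves can be followed to a time t', past sg unless t' = T:
    they have a K-Lipschitz limit q on [t, t'].  The drift estimate at each
    point of q says that q solves the equation; as q t = h t, non-crossing gives
    q = h on [t, t'], which contradicts the choice of sg unless t' = T. *)
Lemma euler_curve_cvg (f : 'cV[R]_n -> R -> 'cV[R]_n) (x0 : 'cV[R]_n)
    (h : R -> 'cV[R]_n) :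
  0 < T -> assumption2 T f -> consistent F T f g -> ivp_solution T f x0 h ->
  x @ F --> x0 -> forall t, 0 <= t <= T -> p t @ F --> h t.
Proof.
move=> T0 [_ uniq] cons [hsol h0] xx0.
pose S := [set t : R |
  0 <= t <= T /\ forall s, 0 <= s <= t -> p s @ F --> h s].
suff [_ ST] : S T by [].
have S0 : S 0.
  split => [|s]; first by rewrite lexx ltW.
  rewrite -eq_le => /eqP <-; rewrite h0.
  have -> : p 0 = x by apply/funext => j; rewrite /p /euler_curve mul0r truncn0.
  exact: xx0.
have hS : has_sup S by split; [exists 0|exists T => s [/andP[]]].
pose sg := sup S.
have sgT : sg <= T by apply: ge_sup => [|s [/andP[]]]; [exists 0|].
have sg0 : 0 <= sg by apply: ub_le_sup S0; exact: hS.2.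
have sgJ : 0 <= sg <= T by rewrite sg0.
have [eta eta0 gv] := cons (h sg) sg sgJ _ ltr01.
set v := f (h sg) sg in gv; pose K := `|v| + 1.
have K0 : 0 < K by rewrite ltr_wpDl.
have eta3 : 0 < eta / 3 by lra.
have [eta' eta'0 hsg] : exists2 eta', 0 < eta' & forall s, `[0, T]%classic s ->
    `|s - sg| < eta' -> `|h s - h sg| <= eta / 4.
  by apply: ode_solution_continuous hsol _ _; rewrite ?divr_gt0//= in_itv.
(* Within time th of sg the estimates hold, and a curve of speed K moves by at
   most eta / 3. *)
pose th := Num.min (eta / 2) (eta / 3 / K).
have th0 : 0 < th by rewrite lt_min divr_gt0//= divr_gt0.
have theta : th <= eta / 2 by rewrite ge_min lexx.
have Kth : K * th <= eta / 3 by rewrite mulrC -ler_pdivlMr// ge_min lexx orbT.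
have tgap0 : 0 < Num.min th eta' by rewrite lt_min th0.
have [t St tgap] := sup_adherent tgap0 hS.
have [/andP[t0 tT] pt] := St.
have tsg : t <= sg by apply: ub_le_sup => //; exact: hS.2.
have gap_th : Num.min th eta' <= th by rewrite ge_min lexx.
have gap_eta' : Num.min th eta' <= eta' by rewrite ge_min lexx orbT.
rewrite -/sg in tgap.
pose t' := Num.min T (t + th).
have tt' : t <= t' by rewrite le_min tT lerDl ltW.
have t'T : t' <= T by rewrite ge_min lexx.
have t'th : t' <= t + th by rewrite ge_min lexx orbT.
have hclose : `|h t - h sg| <= eta / 4.
  apply: hsg; first by rewrite /= in_itv/= t0.
  by rewrite distrC ger0_norm ?subr_ge0//; lra.
have win s : t <= s <= t' -> `|s - sg| < eta.
  by move=> /andP[? ?]; rewrite ltr_norml; lra.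
have step z s1 s2 : t <= s1 -> s1 <= s2 -> s2 <= t' ->
    p s1 @ F --> z -> `|z - h t| <= K * (s1 - t) ->
    exists2 z2, p s2 @ F --> z2 & `|z2 - z| <= K * (s2 - s1).
  move=> ts1 s12 s2t' pz zt.
  have s1t' : s1 <= t' by lra.
  have [||||||z2 pz2 dr] :=
      @euler_drift_limit (h sg) v z sg 1 eta s1 s2 _ gv _ _ _ _ pz.
  - by [].
  - by rewrite (le_trans t0 ts1).
  - lra.
  - by apply: win; rewrite ts1.
  - by apply: win; rewrite (le_trans ts1).
  - have : K * (s1 - t) + K * (s2 - s1) <= eta / 3.
      by rewrite -mulrDr (le_trans _ Kth)// ler_pM2l//; lra.
    rewrite -/K; have := ler_distD (h t) z (h sg); lra.
  exists z2 => //.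
  have -> : z2 - z = (z2 - z - (s2 - s1) *: v) + (s2 - s1) *: v.
    by rewrite subrK.
  rewrite (le_trans (ler_normD _ _))// /K addrC mulrDl lerD//.
  by rewrite normrZ ger0_norm ?subr_ge0// mulrC.
have ptt : p t @ F --> h t by apply: pt; rewrite t0 lexx.
pose q s : 'cV[R]_n := lim (p s @ F).
have pq s : t <= s <= t' -> p s @ F --> q s /\ `|q s - h t| <= K * (s - t).
  move=> /andP[ts st'].
  have [|z pz zt] := @step (h t) t s (lexx _) ts st' ptt.
    by rewrite !subrr normr0 mulr0.
  have qz : q s = z by apply: cvg_lim pz; exact: norm_hausdorff.
  by rewrite qz.
have qlip s1 s2 : t <= s1 -> s1 <= s2 -> s2 <= t' ->
    `|q s2 - q s1| <= K * (s2 - s1).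
  move=> ts1 s12 s2t'.
  have [|pq1 q1] := @pq s1; first by rewrite ts1 (le_trans s12).
  have [z pz zt] := step _ _ _ ts1 s12 s2t' pq1 q1.
  have -> : q s2 = z by apply: cvg_lim pz; exact: norm_hausdorff.
  by [].
have qsol : ode_solution f `[t, t'] q.
  move=> r; rewrite /= in_itv/= => /andP[tr rt'].
  apply/cvgrPdist_le => e e0.
  have rJ : 0 <= r <= T by rewrite (le_trans t0)//= (le_trans rt').
  have [et et0 gr] := cons (q r) r rJ e e0.
  set w := f (q r) r in gr *.
  (* When s2 - s1 < et / K2, the curves leaving q s1 stay within et of q r. *)
  pose K2 := K + (`|w| + e) + 1.
  have K20 : 0 < K2 by rewrite /K2; have := normr_ge0 w; lra.
  apply/nbhs_ballP; exists (et / K2) => /=; first exact: divr_gt0.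
  move=> s; rewrite -ball_normE /= ltr_pdivlMr// => rs nsr.
  rewrite in_itv/= => /andP[ts st'].
  (* Stated for ordered times, since the schemes run forwards: r is s1 or s2
     according to the side from which the difference quotient is taken. *)
  have key s1 s2 : t <= s1 -> s1 <= s2 -> s2 <= t' ->
      `|s1 - r| <= s2 - s1 -> `|s2 - r| <= s2 - s1 -> (s2 - s1) * K2 < et ->
      `|q s2 - q s1 - (s2 - s1) *: w| <= e * (s2 - s1).
    move=> ts1 s12 s2t' s1r s2r small.
    have lt_et u : u <= s2 - s1 -> u < et.
      move=> /le_lt_trans; apply; apply: le_lt_trans small.
      by rewrite ler_peMr ?subr_ge0// /K2; have := normr_ge0 w; lra.
    have [|pq1 q1] := @pq s1; first by rewrite ts1 (le_trans s12).
    have qs1r : `|q s1 - q r| <= K * (s2 - s1).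
      have [s1r'|rs1] := leP s1 r.
        rewrite distrC (le_trans (qlip _ _ ts1 s1r' rt'))// ler_pM2l//.
        by rewrite (le_trans _ s1r)// distrC ler_norm.
      rewrite (le_trans (qlip _ _ tr (ltW rs1) _)) ?(le_trans s12)//.
      by rewrite ler_pM2l// (le_trans _ s1r)// ler_norm.
    have [||||||z2 pz2 dr] :=
      @euler_drift_limit (q r) w (q s1) r e et s1 s2 _ gr _ _ _ _ pq1.
    - exact: ltW.
    - by rewrite (le_trans t0 ts1).
    - exact: le_trans t'T.
    - exact: lt_et.
    - exact: lt_et.
    - apply: le_lt_trans small; rewrite /K2.
      have : 0 <= s2 - s1 by rewrite subr_ge0.
      by move: qs1r; lra.
    have -> : q s2 = z2 by apply: cvg_lim pz2; exact: norm_hausdorff.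
    by [].
  have sr0 : s - r != 0 by rewrite subr_eq0.
  have nq : `|q s - q r - (s - r) *: w| <= e * `|s - r|.
    have [sr|rs'] := leP s r.
      rewrite distrC in rs.
      have := key s r ts sr rt'.
      rewrite subrr normr0 subr_ge0 distrC ger0_norm ?subr_ge0//.
      rewrite distrC ger0_norm ?subr_ge0// in rs.
      move=> /(_ (lexx _) sr rs); congr (_ <= _).
      by rewrite -normrN !opprB -scaleNr opprB addrC.
    have := key r s tr (ltW rs') st'.
    rewrite subrr normr0 subr_ge0 gtr0_norm ?subr_gt0//.
    rewrite distrC gtr0_norm ?subr_gt0// in rs.
    by move=> /(_ (ltW rs') (lexx _) rs).
  have -> : w - (s - r)^-1 *: (q s - q r) =
      - ((s - r)^-1 *: (q s - q r - (s - r) *: w)).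
    by rewrite [in RHS]scalerBr scalerA mulVf// scale1r opprB.
  rewrite normrN normrZ normfV mulrC ler_pdivrMr ?normr_gt0//.
have qh s : t <= s <= t' -> q s = h s.
  move=> ss; apply: (uniq `[t, t']%classic `[0, T]%classic q h).
  - exact: interval_is_interval.
  - exact: interval_is_interval.
  - move=> u; rewrite /= !in_itv/= => /andP[? ?].
    by rewrite (le_trans t0)//= (le_trans _ t'T).
  - by [].
  - exact: qsol.
  - exact: hsol.
  - exists t; first by rewrite /= !in_itv/= lexx t0 tT tt'.
    by apply: cvg_lim ptt; exact: norm_hausdorff.
  - move: ss => /andP[ts st']; rewrite /= !in_itv/= ts st' (le_trans t0)//=.
    by rewrite (le_trans st').
have St' : S t'.
  split => [|s /andP[s0 st']]; first by rewrite (le_trans t0).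
  have [st|ts] := leP s t; first by apply: pt; rewrite s0.
  have ss : t <= s <= t' by rewrite ltW.
  by rewrite -(qh _ ss); exact: (pq _ ss).1.
have [tT'|Tt] := ltP (t + th) T; last first.
  by have <- : t' = T by rewrite /t' min_l.
have : t' <= sg by apply: ub_le_sup => //; exact: hS.2.
by rewrite /t' min_r ?(ltW tT')//; lra.
Qed.
End euler_limit.

(** * Lipschitz approximation of the field, and the step of the scheme *)

(** The truncation level j and the slope j ^ 2 both tend to infinity, the slope
    faster, so that the envelope at z only sees a neighbourhood of z whose size
    tends to 0. *)
Definition lip_field (R : realType) (n : nat) (f : 'cV[R]_n -> R -> 'cV[R]_n)
    (j : nat) (z : 'cV[R]_n) (s : R) : 'cV[R]_n :=
  \col_k lip_envelope j%:R (j%:R ^+ 2) (fun y => f y s k 0) z.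

Lemma lip_field_lipschitz (R : realType) (n : nat)
    (f : 'cV[R]_n -> R -> 'cV[R]_n) (j : nat) (s : R) (y z : 'cV[R]_n) :
  `|lip_field f j y s - lip_field f j z s| <= j%:R ^+ 2 * `|y - z|.
Proof.
apply: ler_cV_norm => [|k]; first by rewrite mulr_ge0// exprn_ge0.
by rewrite !mxE; apply: lip_envelope_lipschitz; rewrite ?exprn_ge0.
Qed.

Lemma lip_field_consistent (R : realType) (n : nat) (T : R)
    (f : 'cV[R]_n -> R -> 'cV[R]_n) (F : set_system nat) :
  Filter F -> \oo `<=` F -> continuous_field T f ->
  consistent F T f (lip_field f).
Proof.
move=> FF FO /subspace_continuousP fc y r rT e e0.
have /cvgr_dist_le/(_ _ e0) :
    f p.1 p.2 @[p --> within ([set: 'cV[R]_n] `*` `[0, T]) (nbhs (y, r))]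
    --> f y r.
  by apply: (fc (y, r)); split => //=; rewrite in_itv.
move=> /nbhs_ballP[eta /= eta0 H].
have fe z s k : `|z - y| < eta -> `|s - r| < eta -> 0 <= s <= T ->
    `|f z s k 0 - f y r k 0| <= e.
  move=> zy sr sT; have := ler_entry_cV_norm (f z s - f y r) k.
  rewrite !mxE => /le_trans; apply; rewrite distrC.
  apply: (H (z, s)); last by split => //=; rewrite in_itv.
  by split; rewrite -ball_normE /= distrC.
exists (eta / 2); first by rewrite divr_gt0.
apply: FO; near=> j => z s zy sr sT.
have jv : `|f y r| + e <= j%:R by near: j; exact: nbhs_infty_ger.
have je : 4 / eta <= j%:R by near: j; exact: nbhs_infty_ger.
apply: ler_cV_norm => [|k]; first exact: ltW.
have vk := ler_entry_cV_norm (f y r) k.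
rewrite !mxE; apply: (@lip_envelope_near _ _ _ _ _ _ _ _ _ _ (eta / 2)).
- by [].
- by rewrite exprn_ge0.
- by rewrite divr_gt0.
- by rewrite (le_trans _ jv)// lerD2r.
- have : 4 * j%:R <= eta * j%:R * j%:R :> R.
    by rewrite ler_wpM2r// mulrC -ler_pdivrMr.
  by rewrite expr2; lra.
- move=> y' zy'; apply: fe => //; last by apply: lt_trans sr _; lra.
  have := ler_distD z y' y; rewrite (distrC y' z); lra.
Unshelve. all: by end_near. Qed.

Lemma mulmx_entry_bound (R : realType) (m n : nat) (A : 'M[R]_(m, n)) (i : 'I_m)
    (y : 'cV[R]_n) :
  `|(A *m y) i 0| <= (\sum_k `|A i k|) * `|y|.
Proof.
rewrite mxE (le_trans (ler_norm_sum _ _ _))// mulr_suml ler_sum// => k _.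
by rewrite normrM ler_wpM2l// ler_entry_cV_norm.
Qed.

Lemma mulmx_entry_cvg (R : realType) (m n : nat) (A : 'M[R]_(m, n)) (i : 'I_m)
    (F : set_system nat) (z_ : nat -> 'cV[R]_n) (z : 'cV[R]_n) :
  Filter F -> z_ @ F --> z -> (A *m z_ j) i 0 @[j --> F] --> (A *m z) i 0.
Proof.
move=> FF zz; apply/cvgrPdist_le => e e0.
set C := \sum_k `|A i k|.
have C0 : 0 <= C by apply: sumr_ge0.
have eC : 0 < e / (C + 1) by rewrite divr_gt0// ltr_wpDl.
near=> j.
have -> : (A *m z) i 0 - (A *m z_ j) i 0 = (A *m (z - z_ j)) i 0.
  by rewrite mulmxBr !mxE.
rewrite (le_trans (mulmx_entry_bound _ _ _))//.
have : `|z - z_ j| <= e / (C + 1) by near: j; exact: cvgr_dist_le.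
rewrite ler_pdivlMr ?ltr_wpDl// => zj; rewrite (le_trans _ zj)// mulrC.
by rewrite ler_wpM2l// lerDl.
Unshelve. all: by end_near. Qed.

(** The step T / N of the scheme for lip_field f j, with N > 2 T j ^ 2 so that
    step times Lipschitz constant is at most 1/2. *)
Definition mesh (R : realType) (T : R) (j : nat) : R :=
  T / (Num.truncn (2 * T * j%:R ^+ 2)).+1%:R.

Lemma mesh_gt0 (R : realType) (T : R) j : 0 < T -> 0 < mesh T j.
Proof. by move=> T0; rewrite divr_gt0. Qed.

Lemma mesh_lipschitz (R : realType) (T : R) j :
  0 < T -> mesh T j * j%:R ^+ 2 <= 2^-1.
Proof.
move=> T0; rewrite /mesh mulrAC ler_pdivrMr//.
by have := truncnS_gt (2 * T * j%:R ^+ 2); lra.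
Qed.

Lemma mesh_cvg (R : realType) (T : R) (F : set_system nat) :
  0 < T -> Filter F -> \oo `<=` F -> mesh T j @[j --> F] --> 0.
Proof.
move=> T0 FF FO; apply/cvgrPdist_le => e e0; apply: FO; near=> j.
have j1 : 1 <= j%:R :> R by near: j; exact: nbhs_infty_ger.
have je : e^-1 <= j%:R by near: j; exact: nbhs_infty_ger.
rewrite sub0r normrN gtr0_norm ?mesh_gt0// leNgt; apply/negP => em.
have := mesh_lipschitz j T0; rewrite leNgt => /negP; apply.
apply: (@lt_le_trans _ _ 1); first by rewrite invf_lt1 ?ltr1n.
have j2 : j%:R <= j%:R ^+ 2 :> R by rewrite expr2 ler_peMl.
apply: (@le_trans _ _ (e * j%:R ^+ 2)); last first.
  by rewrite ler_wpM2r ?exprn_ge0// ltW.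
by rewrite -ler_pdivrMl// mulr1 (le_trans je).
Unshelve. all: by end_near. Qed.

(** * The obstruction *)

(** Euler steps are inverted with the Banach fixed point theorem, which asks for
    the joint structure of complete normed module. *)
HB.instance Definition _ (R : realType) (n : nat) :=
  Uniform_isComplete.Build 'cV[R]_n cauchy_cvg.

Lemma bounded_boundary (R : realType) (n : nat) (V : set 'cV[R]_n) :
  bounded_set V -> exists B, forall x, boundary V x -> `|x| <= B.
Proof.
move=> [M [_ VM]]; exists (`|M| + 1) => x [Vx _].
have cl : closed [set x : 'cV[R]_n | `|x| <= `|M| + 1].
  apply: compact_closed; first exact: norm_hausdorff.
  exact: cV_closed_ball_compact.
suff : closure [set x : 'cV[R]_n | `|x| <= `|M| + 1] x.
  by rewrite -((closure_id _).1 cl).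
apply: (closure_subset _ Vx) => y; apply: VM.
by rewrite (le_lt_trans (ler_norm M))// ltrDl.
Qed.

Theorem theorem2p8 (R : realType) (n nout : nat) (T : R)
    (X U V W : set 'cV[R]_n) (Phi : 'cV[R]_n -> 'cV[R]_nout)
    (c : R) (i : 'I_nout) :
  (0 < n)%N -> 0 < T ->
  {within X, continuous Phi} ->
  connected U -> connected V -> connected W ->
  (* without the next two hypotheses the identity map is a counterexample *)
  U !=set0 -> bounded_set V ->
  U `<=` V -> boundary V `<=` W -> W `<=` X -> U `<=` X ->
  U `&` W = set0 ->
  (forall x, U x -> c < Phi x i 0) ->
  (forall x, W x -> Phi x i 0 < c) ->
  ~ exists (f : 'cV[R]_n -> R -> 'cV[R]_n) (A : 'M[R]_(nout, n)),
      [/\ assumption1 T X f, assumption2 T f & embedded T X Phi f A 0].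
Proof.
move=> n0 T0 _ _ _ _ [u Uu] bV UV bVW WX UX _ PhiU PhiW.
move=> [f [A [[fc ex] a2 emb]]].
have flowP x : X x -> ivp_solution T f x (ivp_flow T f x).
  by move=> Xx; apply: xgetPex; exact: ex.
have PhiE x : X x -> Phi x i 0 = (A *m ivp_flow T f x T) i 0.
  by move=> Xx; rewrite emb// /NODE2 addr0.
pose P j x := euler_curve (mesh T j) (lip_field f j) x T.
(* One scheme is accurate enough at u and on the whole boundary of V. *)
have [j [Pu Pbd]] : exists j, c < (A *m P j u) i 0 /\
    forall x, boundary V x -> (A *m P j x) i 0 <= c.
  apply: contrapT => nj.
  have [F [UF FO]] := @ultraFilterLemma nat \oo _.
  have lim_flow (x_ : nat -> 'cV[R]_n) x : X x -> x_ @ F --> x ->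
      (A *m P j (x_ j)) i 0 @[j --> F] --> Phi x i 0.
    move=> Xx xx; rewrite PhiE//; apply: mulmx_entry_cvg.
    apply: (@euler_curve_cvg _ _ _ _ T _ _ x_ _ _ f x) => //.
    - by move=> j; exact: mesh_gt0.
    - exact: mesh_cvg.
    - exact: lip_field_consistent.
    - exact: flowP.
    - by rewrite lexx ltW.
  (* The choice of x_ j is arbitrary for the j at which the scheme started at u
     does not end above level c; the ultrafilter ignores them. *)
  have bad j : exists x, c < (A *m P j u) i 0 ->
      boundary V x /\ c < (A *m P j x) i 0.
    apply: contrapT => nx; apply: nj; exists j; split.
      by apply: contrapT => nu; apply: nx; exists u.
    move=> x Vx; rewrite leNgt; apply/negP => cx; apply: nx.
    by exists x.
  have [x_ x_bad] := choice bad.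
  have x_near : \forall j \near F,
      boundary V (x_ j) /\ c < (A *m P j (x_ j)) i 0.
    near=> j; apply: x_bad; near: j.
    apply: (cvgr_gt (Phi u i 0)); last exact: PhiU.
    by apply: lim_flow; [exact: UX|exact: cvg_cst].
  have [B VB] := bounded_boundary bV.
  have /cvg_ex[x xx] : cvg (x_ @ F).
    apply: (@ultra_bounded_cvg _ _ _ _ B).
    by apply: filterS x_near => j [/VB].
  have Vx : boundary V x.
    apply: (@closed_cvg _ _ F _ x_) xx; last by apply: filterS x_near => j [].
    rewrite /boundary setDE; apply: closedI; first exact: closed_closure.
    by apply: open_closedC; exact: open_interior.
  have := PhiW _ (bVW _ Vx); rewrite ltNge => /negP; apply.
  have Xx : X x by exact/WX/bVW.
  apply: ler_cvg_to (cvg_cst c) (lim_flow _ _ Xx xx) _.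
  by apply: filterS x_near => j [_ /ltW].
have L t x y :
    `|lip_field f j x t - lip_field f j y t| <= j%:R ^+ 2 * `|x - y|.
  exact: lip_field_lipschitz.
have m0 := ltW (mesh_gt0 j T0); have mL := mesh_lipschitz j T0.
have [|||||||x Vx cx] := @escape_through_boundary R 'cV[R]_n (P j)
    (fun y => (A *m y) i 0) (2 ^+ Num.truncn (T / mesh T j)) c V u (const_mx 1)
    _ _ _ _ _ _ bV _ Pu.
- apply/eqP => /matrixP/(_ (Ordinal n0) 0); rewrite !mxE => /eqP.
  by rewrite oner_eq0.
- by move=> s x y; rewrite mulmxDr -scalemxAr !mxE.
- by rewrite exprn_gt0.
- by move=> y; exact: (euler_surjective m0 mL _ _ L).
- by move=> x y; exact: (euler_bilipschitz m0 mL _ _ _ L).2.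
- by move=> x y; exact: (euler_bilipschitz m0 mL _ _ _ L).1.
- exact: UV.
- by have := Pbd _ Vx; rewrite leNgt cx.
Unshelve. all: by end_near. Qed.
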